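(* Let $E\cup F$ be a regular union graph (of topological graphs $E$ and $F$, with intersection graph $E\cap F$) such that $$E^0_{\mathrm{sing}}\cap(E\cap F)^0_{\mathrm{reg}}\subseteq F^0_{\mathrm{reg}}.$$ Then: (1) $\partial(E\cup F)=\partial E\cup\partial F$; (2) $\partial(E\cap F)=\partial E\cap\partial F$.
   Context: A topological graph $E=(E^0,E^1,s_E,r_E)$ consists of locally compact Hausdorff spaces $E^0,E^1$, a continuous map $s_E:E^1\to E^0$ and a local homeomorphism $r_E:E^1\to E^0$. Define $E^0_{\mathrm{fin}}=\{v\in E^0: v$ has a neighbourhood $V$ with $s_E^{-1}(V)$ compact$\}$, $E^0_{\mathrm{sink}}=E^0\setminus\overline{s_E(E^1)}$, $E^0_{\mathrm{reg}}=E^0_{\mathrm{fin}}\setminus\overline{E^0_{\mathrm{sink}}}$, $E^0_{\mathrm{sing}}=E^0\setminus E^0_{\mathrm{reg}}$. A finite path of length $n\ge1$ is $e_1\cdots e_n$ with $r_E(e_k)=s_E(e_{k+1})$, having range $r_E(e_n)$; vertices are paths of length $0$ with $r_E(v)=v$; $E^*$ is the set of finite paths and $E^\infty$ the set of infinite paths $e_1e_2\cdots$ with $r_E(e_k)=s_E(e_{k+1})$ for all $k$. The boundary path space is $\partial E=E^\infty\cup\{\alpha\in E^*: r_E(\alpha)\in E^0_{\mathrm{sing}}\}$. Closed regular subgraphs: a subgraph $G\subseteq F$ is a topological graph with $G^0\subseteq F^0$, $G^1\subseteq F^1$ subspaces and $s_G,r_G$ the restrictions of $s_F,r_F$; it is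 closed if $G^0,G^1$ are closed. A closed subgraph $G$ is regular if $r_F^{-1}(G^0)\subseteq G^1$ and $G^0$ is negatively invariant, i.e. for every $v\in G^0\cap F^0_{\mathrm{reg}}$ there is $e\in F^1$ with $s_F(e)=v$ and $r_F(e)\in G^0$. A factor map $m:G\to E$ is a pair of proper continuous maps $m_1:G^1\to E^1$, $m_0:G^0\to E^0$ with (F1) $r_E(m_1(e))=m_0(r_G(e))$ and $s_E(m_1(e))=m_0(s_G(e))$ for all $e\in G^1$; and (F2) if $x\in E^1$ and $v\in G^0$ satisfy $r_E(x)=m_0(v)$, there is a unique $e\in G^1$ with $m_1(e)=x$ and $r_G(e)=v$. It is regular if (F3) $m_0(G^0_{\mathrm{sing}})\subseteq E^0_{\mathrm{sing}}$. Regular union graph: let $E,F$ be topological graphs, $G$ a regular closed subgraph of $F$, and $m:G\to E$ an injective regular factor map. The union graph $E\cup F$ has vertex and edge spaces the adjunction spaces $E^0\cup_{m_0}F^0$ and $E^1\cup_{m_1}F^1$, with source and range maps induced from those of $E$ and $F$: on $E^1$ they are $s_E,r_E$, and on $F^1\setminus G^1$ they are $s_F,r_F$ followed by the canonical map $F^0\to E^0\cup_{m_0}F^0$. It is a topological graph, called the regular union graph. One writes $E\cap F:=G$. Then $E,F$ are regarded as (closed regular) subgraphs of $E\cup F$, and $E\cap F$ as a closed regular subgraph of both $E$ and $F$; all paths are regarded as paths in $E\cup F$. *)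

(* Defs.v *)
From HB Require Import structures.
From mathcomp Require Import all_boot all_order all_algebra generic_quotient.
From mathcomp Require Import all_classical.
#[warning="-warn-library-file-internal-analysis"]
From mathcomp Require Import unstable.
From mathcomp Require Import topology.
From Stdlib Require Import Relation_Operators.

Set Implicit Arguments.
Unset Strict Implicit.
Unset Printing Implicit Defensive.

Local Open Scope classical_set_scope.
Local Open Scope quotient_scope.

Definition proper_map (X Y : topologicalType) (f : X -> Y) : Prop :=
  continuous f /\ forall K : set Y, compact K -> compact (f @^-1` K).

(* Every point has an open neighbourhood that f maps homeomorphically (with
   inverse g) onto an open set. *)
Definition local_homeomorphism (X Y : topologicalType) (f : X -> Y) : Prop :=
  forall x : X, exists U : set X,
    [/\ open U, U x, open (f @` U), {within U, continuous f}
      & exists2 g : Y -> X,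
          {within f @` U, continuous g} & forall y, U y -> g (f y) = y].

Section Adjunction.

(* The adjunction space of X and Y along m : A -> X, where A sits in Y via
   i : A -> Y: the disjoint union of X (at index true) and Y (at index false),
   modulo the equivalence relation generated by m a ~ i a. *)
Context (X Y : topologicalType) (A : Type) (m : A -> X) (i : A -> Y).

Definition adj_side (b : bool) : topologicalType := if b then X else Y.

Local Notation disjoint_sum := {b : bool & adj_side b}.

Definition adj_inX (x : X) : disjoint_sum := existT adj_side true x.
Definition adj_inY (y : Y) : disjoint_sum := existT adj_side false y.

Inductive adj_step : disjoint_sum -> disjoint_sum -> Prop :=
  AdjStep (a : A) : adj_step (adj_inX (m a)) (adj_inY (i a)).

Definition adj_rel (p q : disjoint_sum) : bool :=
  `[< clos_refl_sym_trans disjoint_sum adj_step p q >].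

Lemma adj_rel_refl : reflexive adj_rel.
Proof. by move=> p; apply/asboolP; exact: rst_refl. Qed.

Lemma adj_rel_sym : symmetric adj_rel.
Proof. by move=> p q; apply/asboolP/asboolP; exact: rst_sym. Qed.

Lemma adj_rel_trans : transitive adj_rel.
Proof.
by move=> q p r /asboolP pq /asboolP qr; apply/asboolP; exact: rst_trans pq qr.
Qed.

Definition adj_equiv := EquivRel adj_rel adj_rel_refl adj_rel_sym adj_rel_trans.

Definition adjunction : Type := {eq_quot adj_equiv}.

HB.instance Definition _ :=
  Topological.copy adjunction (quotient_topology adjunction).
HB.instance Definition _ := Quotient.on adjunction.

Definition adj_pi (p : disjoint_sum) : adjunction := \pi_adjunction p.

Lemma adj_piP (p q : disjoint_sum) :
  reflect (adj_pi p = adj_pi q) (adj_rel p q).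
Proof. exact: (@eqmodP _ adj_equiv). Qed.

Lemma adj_piK (q : adjunction) : adj_pi (repr q) = q.
Proof. exact: reprK. Qed.

Definition adjl (x : X) : adjunction := adj_pi (adj_inX x).
Definition adjr (y : Y) : adjunction := adj_pi (adj_inY y).

Lemma adj_glue (a : A) : adjl (m a) = adjr (i a).
Proof. by apply/adj_piP/asboolP/rst_step; exact: AdjStep. Qed.

Definition adj_fun (Z : Type) (g : X -> Z) (h : Y -> Z) (b : bool) :
    adj_side b -> Z :=
  if b return adj_side b -> Z then g else h.

(* The map induced on the adjunction space by g on X and h on Y; it is
   evaluated on a chosen representative, hence meaningful when g and h agree
   on A (adj_liftl, adj_liftr). *)
Definition adj_lift (Z : Type) (g : X -> Z) (h : Y -> Z) : adjunction -> Z :=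
  sigT_fun (adj_fun g h) \o repr.

Lemma adj_lift_pi (Z : Type) (g : X -> Z) (h : Y -> Z) (p : disjoint_sum) :
  (forall a, g (m a) = h (i a)) ->
  adj_lift g h (adj_pi p) = sigT_fun (adj_fun g h) p.
Proof.
move=> gh; rewrite /adj_lift /=.
have /asboolP : adj_rel (repr (adj_pi p)) p by apply/adj_piP; exact: adj_piK.
move: (repr _) => q; elim=> {p q} // [_ _ [a]|p q r _ -> _ ->] //=.
exact: gh.
Qed.

Lemma adj_liftl (Z : Type) (g : X -> Z) (h : Y -> Z) (x : X) :
  (forall a, g (m a) = h (i a)) -> adj_lift g h (adjl x) = g x.
Proof. exact: adj_lift_pi. Qed.

Lemma adj_liftr (Z : Type) (g : X -> Z) (h : Y -> Z) (y : Y) :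
  (forall a, g (m a) = h (i a)) -> adj_lift g h (adjr y) = h y.
Proof. exact: adj_lift_pi. Qed.

End Adjunction.

(* The data of a topological graph; the axioms are in topological_graph. *)
Record graph := Graph {
  vert : topologicalType;
  edge : topologicalType;
  src : edge -> vert;
  rng : edge -> vert }.

Arguments src {g}.
Arguments rng {g}.

Definition locally_compact_hausdorff (X : topologicalType) : Prop :=
  locally_compact [set: X] /\ hausdorff_space X.

Definition topological_graph (E : graph) : Prop :=
  [/\ locally_compact_hausdorff (vert E), locally_compact_hausdorff (edge E),
      continuous (@src E) & local_homeomorphism (@rng E)].

Section Vertices.
Context (E : graph).

Definition vfin : set (vert E) :=
  [set v | exists2 V : set (vert E), nbhs v V & compact (src @^-1` V)].

Definition vsink : set (vert E) := ~` closure (range (@src E)).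

Definition vreg : set (vert E) := vfin `\` closure vsink.

Definition vsing : set (vert E) := ~` vreg.

End Vertices.

(* fpath and bpath hold arbitrary sequences of edges; concatenability is
   imposed by finite_paths and infinite_paths. EdgePath e s is the sequence
   e :: s, so that edge paths have length at least 1. *)
Inductive fpath (E : graph) :=
  | VertexPath of vert E
  | EdgePath of edge E & seq (edge E).

Inductive bpath (E : graph) :=
  | FinitePath of fpath E
  | InfinitePath of nat -> edge E.

Definition fpath_rng (E : graph) (p : fpath E) : vert E :=
  match p with
  | VertexPath v => v
  | EdgePath e s => rng (last e s)
  end.

Definition finite_paths (E : graph) : set (fpath E) :=
  [set p | match p with
           | VertexPath _ => True
           | EdgePath e s => path (fun a b => rng a == src b) e s
           end].

Definition infinite_paths (E : graph) : set (nat -> edge E) :=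
  [set x | forall k, rng (x k) = src (x k.+1)].

Definition boundary (E : graph) : set (bpath E) :=
  [set InfinitePath x | x in @infinite_paths E] `|`
  [set FinitePath p | p in
     [set p | finite_paths p /\ vsing (fpath_rng p)]].

(* A pair of maps, with no compatibility imposed; see factor_map. *)
Record gmap (E F : graph) := GMap {
  vmap : vert E -> vert F;
  emap : edge E -> edge F }.

Definition gmap_comp (E F H : graph) (n : gmap F H) (m : gmap E F) : gmap E H :=
  GMap (vmap n \o vmap m) (emap n \o emap m).

Definition fpath_map (E F : graph) (m : gmap E F) (p : fpath E) : fpath F :=
  match p with
  | VertexPath v => VertexPath (vmap m v)
  | EdgePath e s => EdgePath (emap m e) (map (emap m) s)
  end.

Definition bpath_map (E F : graph) (m : gmap E F) (p : bpath E) : bpath F :=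
  match p with
  | FinitePath a => FinitePath (fpath_map m a)
  | InfinitePath x => InfinitePath (emap m \o x)
  end.

Record subgraph (F : graph) := Subgraph {
  sub_vert : set (vert F);
  sub_edge : set (edge F);
  sub_src : forall e, sub_edge e -> sub_vert (src e);
  sub_rng : forall e, sub_edge e -> sub_vert (rng e) }.

(* The types set_type _ carry the subspace topology. *)
Definition graph_of_subgraph (F : graph) (G : subgraph F) : graph :=
  @Graph (set_type (sub_vert G)) (set_type (sub_edge G))
    (fun e => SigSub (mem_set (sub_src (set_valP e))))
    (fun e => SigSub (mem_set (sub_rng (set_valP e)))).

Coercion graph_of_subgraph : subgraph >-> graph.

Definition sub_incl (F : graph) (G : subgraph F) : gmap G F :=
  @GMap G F set_val set_val.

Definition negatively_invariant (F : graph) (V : set (vert F)) : Prop :=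
  forall v, V v -> vreg v -> exists2 e : edge F, src e = v & V (rng e).

Definition closed_regular_subgraph (F : graph) (G : subgraph F) : Prop :=
  [/\ topological_graph G,
      closed (sub_vert G) /\ closed (sub_edge G),
      rng @^-1` sub_vert G `<=` sub_edge G
    & negatively_invariant (sub_vert G)].

Definition factor_map (G E : graph) (m : gmap G E) : Prop :=
  [/\ proper_map (emap m) /\ proper_map (vmap m),
      forall e, rng (emap m e) = vmap m (rng e),
      forall e, src (emap m e) = vmap m (src e)
    & forall (x : edge E) (v : vert G), rng x = vmap m v ->
        exists! e : edge G, emap m e = x /\ rng e = v].

Definition regular_factor_map (G E : graph) (m : gmap G E) : Prop :=
  factor_map m /\ vmap m @` @vsing G `<=` @vsing E.

Definition injective_gmap (G E : graph) (m : gmap G E) : Prop :=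
  injective (vmap m) /\ injective (emap m).

Section Union.
Context (E F : graph) (G : subgraph F) (m : gmap G E).

Definition union_vert : topologicalType :=
  adjunction (vmap m) (vmap (sub_incl G)).

Definition union_edge : topologicalType :=
  adjunction (emap m) (emap (sub_incl G)).

Definition union_vertl : vert E -> union_vert :=
  adjl (vmap m) (vmap (sub_incl G)).

Definition union_vertr : vert F -> union_vert :=
  adjr (vmap m) (vmap (sub_incl G)).

Definition union_graph : graph :=
  @Graph union_vert union_edge
    (adj_lift (union_vertl \o src) (union_vertr \o src))
    (adj_lift (union_vertl \o rng) (union_vertr \o rng)).

Definition union_inl : gmap E union_graph :=
  @GMap E union_graph union_vertl (adjl (emap m) (emap (sub_incl G))).

Definition union_inr : gmap F union_graph :=
  @GMap F union_graph union_vertr (adjr (emap m) (emap (sub_incl G))).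

Definition union_inI : gmap G union_graph := gmap_comp union_inr (sub_incl G).

Lemma union_inIE : union_inI = gmap_comp union_inl m.
Proof.
by congr GMap; apply/funext => a /=; symmetry; exact: adj_glue.
Qed.

Lemma union_srcl (e : edge E) : factor_map m ->
  src (emap union_inl e) = vmap union_inl (src e).
Proof.
by move=> [_ _ ms _]; apply: adj_liftl => a /=; rewrite ms; exact: adj_glue.
Qed.

Lemma union_srcr (e : edge F) : factor_map m ->
  src (emap union_inr e) = vmap union_inr (src e).
Proof.
by move=> [_ _ ms _]; apply: adj_liftr => a /=; rewrite ms; exact: adj_glue.
Qed.

Lemma union_rngl (e : edge E) : factor_map m ->
  rng (emap union_inl e) = vmap union_inl (rng e).
Proof.
by move=> [_ mr _ _]; apply: adj_liftl => a /=; rewrite mr; exact: adj_glue.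
Qed.

Lemma union_rngr (e : edge F) : factor_map m ->
  rng (emap union_inr e) = vmap union_inr (rng e).
Proof.
by move=> [_ mr _ _]; apply: adj_liftr => a /=; rewrite mr; exact: adj_glue.
Qed.

End Union.

(* Main.v *)
(* The canonical maps of E, F into the union U, like m and the inclusion of
   G := E n F into F, are injective factor maps that are closed embeddings.  A
   path of U whose range lies in E (in F) has all its edges in E (in F), because
   factor maps lift edges along ranges; hence every path of U is a path of E or
   of F, and it remains to compare singular vertices.  A vertex that is regular
   in those of E, F to which it belongs is regular in U.  Conversely E and F are
   negatively invariant in U: a regular vertex of U emits an edge of U, and if
   it lies in G, then it is regular in G (union_vreg_inI), so that it emits an
   edge of G.  Thus U_sing is the union of E_sing and F_sing, while G_sing is
   their intersection by hsing. *)
Require Import Defs.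
From mathcomp Require Import all_boot all_classical topology.

Local Open Scope classical_set_scope.

(** * Closed embeddings and proper maps *)

Definition closed_embedding {X Y : topologicalType} (f : X -> Y) : Prop :=
  [/\ continuous f, injective f & forall C, closed C -> closed (f @` C)].

Lemma preimage_image_inj {T U : Type} (f : T -> U) (C : set T) :
  injective f -> f @^-1` (f @` C) = C.
Proof.
by move=> fi; apply/seteqP; split=> [x [y Cy /fi <-]//|x Cx]; exists x.
Qed.

Lemma closureI_nbhs {T : topologicalType} (A V : set T) (v : T) :
  nbhs v V -> closure A v -> closure (A `&` V) v.
Proof.
move=> nV cA B nB; have [x [Ax [Vx Bx]]] := cA _ (filterI nV nB).
by exists x.
Qed.

Lemma notin_closureC {T : topologicalType} (A : set T) (v : T) :
  ~ closure (~` A) v <-> nbhs v A.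
Proof.
split=> [|nA /(_ _ nA)[x []]//].
by rewrite -[~ _]/((~` closure (~` A)) v) -interiorC setCK.
Qed.

Lemma locally_compact_nbhs {T : topologicalType} (v : T) :
  locally_compact_hausdorff T -> exists2 K : set T, nbhs v K & compact K.
Proof.
move=> [lcT _]; have := lcT v I.
by rewrite withinET => -[K nK [cK _]]; exists K.
Qed.

Lemma locally_compact_closed_nbhs {T : topologicalType} (v : T) (A : set T) :
  locally_compact_hausdorff T -> nbhs v A ->
  exists B, [/\ nbhs v B, closed B & B `<=` A].
Proof.
move=> lcT nA; have [K nK cK] := locally_compact_nbhs v lcT.
have [B nB BA] := compact_regular lcT.2 cK nK nA.
exists (closure B); split=> //; last exact: closed_closure.
by apply: filterS nB; exact: subset_closure.
Qed.

(** Near [y] only the part of [C] over a compact neighbourhood of [y] matters; properness makes that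
    part compact, so its image is closed in the Hausdorff space [Y]. *)
Lemma proper_closed {X Y : topologicalType} (f : X -> Y) (C : set X) :
  locally_compact_hausdorff Y -> proper_map f -> closed C ->
  closed (f @` C).
Proof.
move=> lcY [fc fp] cC y cy; have [K nK cK] := locally_compact_nbhs y lcY.
have cfCK : closed (f @` (f @^-1` K `&` C)).
  apply: compact_closed; first exact: lcY.2.
  apply: continuous_compact; first exact: continuous_subspaceT.
  by apply: compact_closedI => //; exact: fp.
have : closure (f @` (f @^-1` K `&` C)) y.
  apply: closure_subset (closureI_nbhs _ _ _ nK cy).
  by move=> _ [[x Cx <-] Kfx]; exists x.
by move=> /cfCK[x [_ Cx] <-]; exists x.
Qed.

Lemma closed_embedding_closure {X Y : topologicalType} (f : X -> Y)
    (A : set X) :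
  closed_embedding f -> closure (f @` A) = f @` closure A.
Proof.
move=> [fc _ fcl]; apply/seteqP; split.
  have cfA : closed (f @` closure A) by apply: fcl; exact: closed_closure.
  rewrite [X in _ `<=` X](closure_id _).1//; apply: closure_subset.
  by apply: image_subset; exact: subset_closure.
move=> _ [x cx <-] V nV; have [a [Aa Va]] := cx _ (fc _ _ nV).
by exists (f a); split=> //; exists a.
Qed.

(** A filter on the preimage of [K] pushes forward to one on [K], which clusters at some [y]. The
    range is closed, so [y] has a preimage, and the original filter clusters there. *)
Lemma closed_embedding_proper {X Y : topologicalType} (f : X -> Y) :
  closed_embedding f -> proper_map f.
Proof.
move=> [fc fi fcl]; split=> // K cK F PF FK.
have FfK : (f @ F) K by [].
have [y [Ky clFy]] := cK (f @ F) (fmap_proper_filter _ PF) FfK.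
have [[x _ fx]|ny] := pselect (range f y).
  exists x; split; first by rewrite /preimage /= fx.
  move=> A B FA nB.
  (* The complement of a closed image; [f] sends only interior points of [B] into it. *)
  have nfB : nbhs y (~` (f @` ~` B°)).
    apply: open_nbhs_nbhs; split.
      by rewrite openC; apply: fcl; rewrite closedC; exact: open_interior.
    by rewrite -fx => -[x' nBx' /fi xx']; apply: nBx'; rewrite xx'.
  have FfA : F (f @^-1` (f @` A)).
    by apply: filterS FA => a Aa; exists a.
  have [_ [[a Aa <-] naB]] := clFy _ _ FfA nfB.
  exists a; split=> //; apply: interior_subset.
  by apply: contrapT => nBa; apply: naB; exists a.
have nfB : nbhs y (~` range f).
  apply: open_nbhs_nbhs; split=> //.
  by rewrite openC; apply: fcl; exact: closedT.
have [//|_ [[a _ <-] []]] := clFy (range f) _ _ nfB.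
  rewrite -[_ (range f)]/(F (f @^-1` range f)).
  by apply: filterS filterT => a _; exists a.
by exists a.
Qed.

Lemma proper_closed_embedding {X Y : topologicalType} (f : X -> Y) :
  locally_compact_hausdorff Y -> proper_map f -> injective f ->
  closed_embedding f.
Proof.
by move=> lcY pf fi; split=> [||C] //; [case: pf|exact: proper_closed].
Qed.

Lemma set_val_closed_embedding {X : topologicalType} (A : set X) :
  closed A -> closed_embedding (set_val : A -> X).
Proof.
move=> cA; split; [exact: initial_continuous|exact: val_inj|].
move=> C; rewrite -openC => -[B oB BC].
have -> : set_val @` C = A `&` ~` B.
  have BCE (x : A) : B (set_val x) = (~` C) x by rewrite -BC.
  apply/seteqP; split=> [_ [x Cx <-]|x [Ax nBx]].
    by split; [exact: set_valP|move: Cx; apply: contraPnot; rewrite BCE].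
  exists (SigSub (mem_set Ax)) => //.
  apply: contrapT => nC; apply: nBx.
  by rewrite -[x]/(set_val (SigSub (mem_set Ax) : A)) BCE.
by apply: closedI => //; rewrite closedC.
Qed.

(** * Adjunction spaces along two closed embeddings *)

Section AdjunctionSpace.
Context {X Y A : topologicalType} {m : A -> X} {i : A -> Y}.
Hypotheses (em : closed_embedding m) (ei : closed_embedding i).

Local Notation inX := (adjl m i).
Local Notation inY := (adjr m i).

Lemma adj_ind (P : adjunction m i -> Prop) :
  (forall x, P (inX x)) -> (forall y, P (inY y)) -> forall u, P u.
Proof. by move=> PX PY u; rewrite -(adj_piK u); case: (repr u) => -[]. Qed.

(* A normal form for the points of the adjunction space: the image of X,
   followed by the points of Y outside A. *)
Let nfY (y : Y) : X + Y :=
  if pselect (exists a, i a = y) is left ya then inl (m (projT1 (cid ya)))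
  else inr y.

Let nf := adj_lift (m := m) (i := i) inl nfY.

Let nfYi a : inl (m a) = nfY (i a).
Proof.
case: ei => _ ii _; rewrite /nfY; case: pselect => [ya|[]]; last by exists a.
by case: cid => b /= /ii ->.
Qed.

Let nfX x : nf (inX x) = inl x.
Proof. exact: adj_liftl nfYi. Qed.

Let nfYE y : nf (inY y) = nfY y.
Proof. exact: adj_liftr nfYi. Qed.

Lemma adjl_inj : injective inX.
Proof. by move=> x x' /(congr1 nf); rewrite !nfX => -[]. Qed.

Lemma adjlr_eq x y : inX x = inY y -> exists2 a, x = m a & y = i a.
Proof.
move=> /(congr1 nf); rewrite nfX nfYE /nfY; case: pselect => // ya [->].
by case: cid => a /= <-; exists a.
Qed.

Lemma adjr_inj : injective inY.
Proof.
move=> y y' e; have := congr1 nf e; rewrite !nfYE /nfY.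
case: pselect => [ya|_]; case: pselect => // ya' [] //.
case: cid => a /= <-; case: cid => a' /= <-.
by case: em => _ mi _ /mi ->.
Qed.

Lemma adjl_continuous : continuous inX.
Proof.
move=> x; apply: (@continuous_comp _ _ _ (existT (adj_side X Y) true)).
  exact: existT_continuous.
exact: pi_continuous.
Qed.

Lemma adjr_continuous : continuous inY.
Proof.
move=> y; apply: (@continuous_comp _ _ _ (existT (adj_side X Y) false)).
  exact: existT_continuous.
exact: pi_continuous.
Qed.

Lemma adj_closed (C : set (adjunction m i)) :
  closed (inX @^-1` C) -> closed (inY @^-1` C) -> closed C.
Proof.
rewrite -!openC => oX oY; apply/sigT_openP => -[].
  exact: oX.
exact: oY.
Qed.

Lemma preimage_adjl_adjr (C : set X) :
  inY @^-1` (inX @` C) = i @` (m @^-1` C).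
Proof.
apply/seteqP; split=> [y [x Cx /adjlr_eq[a xa ->]]|_ [a Cma <-]].
  by exists a => //; rewrite /preimage /= -xa.
by exists (m a) => //; exact: adj_glue.
Qed.

Lemma preimage_adjr_adjl (C : set Y) :
  inX @^-1` (inY @` C) = m @` (i @^-1` C).
Proof.
apply/seteqP; split=> [x [y Cy /esym/adjlr_eq[a -> ya]]|_ [a Cia <-]].
  by exists a => //; rewrite /preimage /= -ya.
by exists (i a) => //; rewrite -adj_glue.
Qed.

(** The image of a closed [C] has preimage [C] in [X], and in [Y] the [i]-image of the [m]-preimage
    of [C]; both are closed. *)
Lemma adjl_closed_embedding : closed_embedding inX.
Proof.
case: em => mc _ _; case: ei => _ _ icl.
split=> [||C cC]; [exact: adjl_continuous|exact: adjl_inj|].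
apply: adj_closed; first by rewrite preimage_image_inj//; exact: adjl_inj.
rewrite preimage_adjl_adjr; apply: icl.
by apply: preimage_closed => // ? _; exact: mc.
Qed.

Lemma adjr_closed_embedding : closed_embedding inY.
Proof.
case: em => _ _ mcl; case: ei => ic _ _.
split=> [||C cC]; [exact: adjr_continuous|exact: adjr_inj|].
apply: adj_closed; last by rewrite preimage_image_inj//; exact: adjr_inj.
rewrite preimage_adjr_adjl; apply: mcl.
by apply: preimage_closed => // ? _; exact: ic.
Qed.

(** The complements of the interiors of [B] and [C] have closed images that miss [u]; what avoids
    both images is open and lies in the given set. *)
Lemma adj_nbhs_sub (u : adjunction m i) (B : set X) (C : set Y) :
  (forall x, inX x = u -> nbhs x B) -> (forall y, inY y = u -> nbhs y C) ->
  nbhs u [set w | (forall x, inX x = w -> B x) /\ (forall y, inY y = w -> C y)].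
Proof.
move=> nB nC.
have [_ Xi Xcl] := adjl_closed_embedding.
have [_ Yi Ycl] := adjr_closed_embedding.
apply: (@filterS _ _ _ (~` (inX @` (~` B°) `|` inY @` (~` C°)))).
  by move=> w nw; split=> [x|y] E; apply: interior_subset;
    apply: contrapT => nx; apply: nw; [left; exists x|right; exists y].
apply: open_nbhs_nbhs; split.
  by rewrite openC; apply: closedU; [apply: Xcl|apply: Ycl];
     rewrite closedC; exact: open_interior.
by move=> [[x nx xu]|[y ny yu]]; [exact/nx/nB|exact/ny/nC].
Qed.

Lemma nbhs_adj (u : adjunction m i) (W : set (adjunction m i)) :
  (forall x, inX x = u -> nbhs x (inX @^-1` W)) ->
  (forall y, inY y = u -> nbhs y (inY @^-1` W)) ->
  nbhs u W.
Proof.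
move=> WX WY; apply: filterS (adj_nbhs_sub _ _ _ WX WY).
by elim/adj_ind => [x [/(_ x) + _]|y [_ /(_ y)]]; exact.
Qed.

(** [K] is the union of the images of closed neighbourhoods taken on each side. Choosing them inside
    the set of [adj_nbhs_sub] keeps the trace of each image on the other side within [B] or [C]. *)
Lemma adj_closed_nbhs (u : adjunction m i) (B : set X) (C : set Y) :
  locally_compact_hausdorff X -> locally_compact_hausdorff Y ->
  (forall x, inX x = u -> nbhs x B) -> (forall y, inY y = u -> nbhs y C) ->
  exists K, [/\ nbhs u K, closed K, inX @^-1` K `<=` B & inY @^-1` K `<=` C].
Proof.
move=> lcX lcY nB nC.
have [Xc Xi Xcl] := adjl_closed_embedding.
have [Yc Yi Ycl] := adjr_closed_embedding.
have := adj_nbhs_sub _ _ _ nB nC; set N := [set _ | _] => nN.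
have [B' [nB' cB' B'N]] : exists B' : set X,
    [/\ forall x, inX x = u -> nbhs x B', closed B' & B' `<=` inX @^-1` N].
  have [[x xu]|nx] := pselect (exists x, inX x = u); last first.
    (* If [u] does not come from [X], the neighbourhood condition is vacuous and the empty set
       serves. *)
    by exists set0; split=> // [x xu|]; [case: nx; exists x|exact: closed0].
  have nNx : nbhs x (inX @^-1` N) by apply: Xc; rewrite xu.
  have [B' [nB' cB' B'N]] := locally_compact_closed_nbhs _ _ lcX nNx.
  by exists B'; split=> // x'; rewrite -xu => /Xi ->.
have [C' [nC' cC' C'N]] : exists C' : set Y,
    [/\ forall y, inY y = u -> nbhs y C', closed C' & C' `<=` inY @^-1` N].
  have [[y yu]|ny] := pselect (exists y, inY y = u); last first.
    by exists set0; split=> // [y yu|]; [case: ny; exists y|exact: closed0].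
  have nNy : nbhs y (inY @^-1` N) by apply: Yc; rewrite yu.
  have [C' [nC' cC' C'N]] := locally_compact_closed_nbhs _ _ lcY nNy.
  by exists C'; split=> // y'; rewrite -yu => /Yi ->.
have KN : inX @` B' `|` inY @` C' `<=` N.
  by move=> _ [[x /B'N Nx <-]|[y /C'N Ny <-]].
exists (inX @` B' `|` inY @` C'); split.
- apply: nbhs_adj => [x /nB'|y /nC']; apply: filterS => z ?.
    by left; exists z.
  by right; exists z.
- by apply: closedU; [exact: Xcl|exact: Ycl].
- by move=> x /KN[+ _]; exact.
- by move=> y /KN[_]; exact.
Qed.

End AdjunctionSpace.

(** * Finite, regular and singular vertices *)

Lemma vreg_nbhs {E : graph} (v : vert E) : vreg v -> nbhs v (@vreg E).
Proof.
move=> [[V nV cV] nv]; apply: filterI; last first.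
  by apply: open_nbhs_nbhs; split=> //; rewrite openC; exact: closed_closure.
by apply: filterS (nbhs_interior nV) => w nw; exists V.
Qed.

Lemma vsink_open (E : graph) : open (@vsink E).
Proof. by rewrite openC; exact: closed_closure. Qed.

(** The sinks are the complement of the closed set of limits of sources, so avoiding their closure
    means being interior to that set. *)
Lemma vregP {E : graph} (v : vert E) :
  vreg v <-> vfin v /\ nbhs v (closure (range (@src E))).
Proof. by split=> -[fv] /notin_closureC cv; split. Qed.

Lemma vsing_vfin_sink {E : graph} (v : vert E) :
  vsing v -> vfin v -> closure (@vsink E) v.
Proof. by move=> sv fv; apply: contrapT => nv; apply: sv. Qed.

(** Over a neighbourhood with compact source preimage the sources form a compact, hence closed set,
    so a limit of sources at [v] is a source. *)
Lemma vfin_emits {E : graph} (v : vert E) :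
  topological_graph E -> vfin v -> closure (range (@src E)) v ->
  range (@src E) v.
Proof.
move=> [[_ hE] _ sc _] [V nV cV] cv.
have csV : closed (src @` (src @^-1` V)).
  apply: compact_closed => //; apply: continuous_compact => //.
  exact: continuous_subspaceT.
have /csV[e _ <-] : closure (src @` (src @^-1` V)) v.
  apply: closure_subset (closureI_nbhs _ _ _ nV cv).
  by move=> _ [[e _ <-] Ve]; exists e.
by exists e.
Qed.

Lemma vreg_emits {E : graph} (v : vert E) :
  topological_graph E -> vreg v -> range (@src E) v.
Proof.
by move=> tE /vregP[fv /nbhs_singleton cv]; exact: vfin_emits.
Qed.

(** * Injective factor maps and lifting of paths *)

Lemma closed_embedding_factor_map {H U : graph} (f : gmap H U) :
  closed_embedding (vmap f) -> closed_embedding (emap f) ->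
  (forall e, rng (emap f e) = vmap f (rng e)) ->
  (forall e, src (emap f e) = vmap f (src e)) ->
  (forall e v, rng e = vmap f v -> range (emap f) e) ->
  factor_map f /\ injective_gmap f.
Proof.
move=> ev ee fr fs lift; have [_ vi _] := ev; have [_ ei _] := ee.
do 2?split=> //; first by split; exact: closed_embedding_proper.
(* Injectivity on vertices shows that the lifted edge has range [v]; injectivity on edges makes it
   unique. *)
move=> _ v /[dup] /lift[e _ <-]; rewrite fr => /vi re.
by exists e; split=> // e' [/ei ->].
Qed.

Section InjectiveFactorMap.
Context {H U : graph} (f : gmap H U).
Hypotheses (ff : factor_map f) (fi : injective_gmap f).

Lemma vfin_factor_map v : vfin (vmap f v) -> vfin v.
Proof.
case: ff => [[[_ ep] [vc _]] _ fs _] [V nV cV].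
exists (vmap f @^-1` V); first exact: vc.
have -> : src @^-1` (vmap f @^-1` V) = emap f @^-1` (src @^-1` V).
  by apply/seteqP; split=> e; rewrite /preimage /= fs.
exact: ep.
Qed.

(** Being regular in [U] is an open condition, so all vertices of [H] near [v] emit edges of [H];
    finiteness pulls back by properness. Contrapositively, this is how singular vertices are shown
    to stay singular. *)
Lemma vreg_factor_map :
  (forall v, vreg (vmap f v) -> range (@src H) v) ->
  forall v, vreg (vmap f v) -> vreg v.
Proof.
case: ff => [[_ [vc _]] _ _ _] emits v rv; apply/vregP; split.
  by apply: vfin_factor_map; case: rv.
have : nbhs v (vmap f @^-1` @vreg U) by apply: vc; exact: vreg_nbhs.
apply: filterS => w /emits.
exact: subset_closure.
Qed.

Lemma rng_lift e v : rng e = vmap f v -> range (emap f) e.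
Proof.
by case: ff => _ _ _ lift /lift[e' [[<- _] _]]; exists e'.
Qed.

Lemma fpath_rng_map p : fpath_rng (fpath_map f p) = vmap f (fpath_rng p).
Proof. by case: ff => _ fr _ _; case: p => //= e s; rewrite last_map fr. Qed.

Lemma finite_paths_map p : finite_paths (fpath_map f p) <-> finite_paths p.
Proof.
case: ff => _ fr fs _; case: p => //= e s; rewrite /finite_paths /= path_map.
by rewrite (@eq_path _ _ (fun a b => rng a == src b))// => a b /=;
  rewrite fr fs (inj_eq fi.1).
Qed.

(** Lifting runs backwards: the last edge lifts because its range does, and the source of a lifted
    edge lifts the range of the preceding edge. *)
Lemma fpath_lift p v : finite_paths p -> fpath_rng p = vmap f v ->
  range (fpath_map f) p.
Proof.
case: ff => _ _ fs _.
case: p => [w _ /= ->|e s]; first by exists (VertexPath v).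
suff lift : path (fun a b => rng a == src b) e s ->
    rng (last e s) = vmap f v ->
    exists e' s', e = emap f e' /\ s = map (emap f) s'.
  by move=> /lift /[apply] -[e' [s' [-> ->]]]; exists (EdgePath e' s').
elim: s e => [e _ /= /rng_lift[e' _ <-]|a s IHs e /= /andP[/eqP ea ps] rs].
  by exists e', [::].
have [a' [s' [aE ->]]] := IHs a ps rs.
move: ea; rewrite aE fs => /rng_lift[e' _ <-].
by exists e', (a' :: s').
Qed.

Lemma infinite_paths_map x : infinite_paths (emap f \o x) <-> infinite_paths x.
Proof.
case: ff => _ fr fs _; split=> px k; have := px k => /=; last first.
  by rewrite fr fs => ->.
by rewrite fr fs; apply: fi.1.
Qed.

Lemma infinite_paths_prefix x n k : infinite_paths x ->
  range (emap f) (x n) -> (k <= n)%N -> range (emap f) (x k).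
Proof.
move=> px xn kn; case: ff => _ _ fs _.
(* Downward induction from [n] by the distance [d]; once the index is 0, truncated subtraction makes
   the step trivial. *)
suff : forall d, range (emap f) (x (n - d)%N).
  by move=> /(_ (n - k)%N); rewrite subKn.
elim=> [|d]; first by rewrite subn0.
rewrite subnS; case: (n - d)%N => // l [e _ eE].
by apply: (@rng_lift _ (src e)); rewrite px -eE.
Qed.

Lemma boundary_lift_infinite x : infinite_paths x ->
  (forall k, range (emap f) (x k)) ->
  (bpath_map f @` @boundary H) (InfinitePath x).
Proof.
move=> px xf; have fE k : emap f (projT1 (cid2 (xf k))) = x k.
  by case: cid2.
have xE : emap f \o (fun k => projT1 (cid2 (xf k))) = x by exact/funext.
exists (InfinitePath (fun k => projT1 (cid2 (xf k)))); last by rewrite /= xE.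
by left; eexists => //; apply/infinite_paths_map; rewrite xE.
Qed.

Lemma boundary_lift_finite p v : finite_paths p ->
  fpath_rng p = vmap f v -> vsing v ->
  (bpath_map f @` @boundary H) (FinitePath p).
Proof.
move=> pp pv sv; have [q _ qp] := fpath_lift _ _ pp pv.
exists (FinitePath q); last by rewrite /= qp.
right; exists q => //; split; first by apply/finite_paths_map; rewrite qp.
suff -> : fpath_rng q = v by [].
by apply: fi.1; rewrite -fpath_rng_map qp.
Qed.

Lemma boundary_factor_map : vmap f @` @vsing H `<=` @vsing U ->
  bpath_map f @` @boundary H `<=` @boundary U.
Proof.
move=> sf _ [_ [[x px <-]|[p [pp sp] <-]] <-]; [left|right].
  by exists (emap f \o x) => //; apply/infinite_paths_map.
exists (fpath_map f p) => //; split; first exact/finite_paths_map.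
by rewrite fpath_rng_map; apply: sf; exists (fpath_rng p).
Qed.

End InjectiveFactorMap.

(** * The inclusion of a closed regular subgraph *)

Section ClosedRegularSubgraph.
Context {F : graph} (G : subgraph F).
Hypothesis regG : closed_regular_subgraph G.

Lemma sub_incl_closed_embedding :
  closed_embedding (vmap (sub_incl G)) /\ closed_embedding (emap (sub_incl G)).
Proof.
by case: regG => _ [cv ce] _ _; split; exact: set_val_closed_embedding.
Qed.

Lemma sub_incl_factor_map :
  factor_map (sub_incl G) /\ injective_gmap (sub_incl G).
Proof.
have [ev ee] := sub_incl_closed_embedding; case: regG => _ _ rG _.
apply: closed_embedding_factor_map => // e v ev'.
have Ge : sub_edge G e.
  by apply: rG; rewrite /preimage /= ev'; exact: set_valP.
by exists (SigSub (mem_set Ge)).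
Qed.

(** At a vertex of [G] regular in [F], negative invariance gives an edge with range in [G]; it
    belongs to [G] because edges lift along ranges, so [vreg_factor_map] applies. *)
Lemma sub_incl_vsing : vmap (sub_incl G) @` @vsing G `<=` @vsing F.
Proof.
have [ff fi] := sub_incl_factor_map.
move=> _ [v sv <-] rv; apply: sv; move: v rv.
apply: (vreg_factor_map _ ff) => v rv.
case: regG => _ _ _ /(_ _ (set_valP v) rv)[e ev Gre].
have [e' _ ee] : range (emap (sub_incl G)) e.
  by apply: (rng_lift _ ff _ (SigSub (mem_set Gre))).
exists e' => //; apply: fi.1; case: ff => _ _ fs _.
by rewrite -fs ee ev.
Qed.

End ClosedRegularSubgraph.

(** * The canonical maps into the regular union *)

Section RegularUnion.
Context {E F : graph} (G : subgraph F) (m : gmap G E).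
Hypotheses (topE : topological_graph E) (topF : topological_graph F).
Hypotheses (regG : closed_regular_subgraph G).
Hypotheses (regm : regular_factor_map m) (injm : injective_gmap m).

Local Notation U := (union_graph m).
Local Notation inE := (union_inl m).
Local Notation inF := (union_inr m).
Local Notation inG := (union_inI m).
Local Notation incl := (sub_incl G).

Let topG : topological_graph G. Proof. by case: regG. Qed.
Let fm : factor_map m. Proof. by case: regm. Qed.

Let em : closed_embedding (vmap m) /\ closed_embedding (emap m).
Proof.
have [[pe pv] _ _ _] := fm; case: topE => lv le _ _; case: injm => iv ie.
by split; exact: proper_closed_embedding.
Qed.

Let ei : closed_embedding (vmap incl) /\ closed_embedding (emap incl).
Proof. exact: sub_incl_closed_embedding. Qed.

Let vl : closed_embedding (vmap inE).
Proof. exact: adjl_closed_embedding em.1 ei.1. Qed.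

Let vr : closed_embedding (vmap inF).
Proof. exact: adjr_closed_embedding em.1 ei.1. Qed.

Let el : closed_embedding (emap inE).
Proof. exact: adjl_closed_embedding em.2 ei.2. Qed.

Let er : closed_embedding (emap inF).
Proof. exact: adjr_closed_embedding em.2 ei.2. Qed.

Lemma union_edge_ind (P : edge U -> Prop) :
  (forall x, P (emap inE x)) -> (forall y, P (emap inF y)) -> forall u, P u.
Proof. exact: adj_ind. Qed.

Lemma union_vlr x y : vmap inE x = vmap inF y ->
  exists2 g, x = vmap m g & y = vmap incl g.
Proof. exact: adjlr_eq ei.1 _ _. Qed.

Lemma union_elr x y : emap inE x = emap inF y ->
  exists2 g, x = emap m g & y = emap incl g.
Proof. exact: adjlr_eq ei.2 _ _. Qed.

Lemma union_vglue g : vmap inE (vmap m g) = vmap inF (vmap incl g).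
Proof. exact: adj_glue. Qed.

Lemma union_eglue g : emap inE (emap m g) = emap inF (emap incl g).
Proof. exact: adj_glue. Qed.

(** An edge of [F] whose range lies in [E] has its range in [G], hence belongs to [G] and is
    identified with an edge of [E]. *)
Lemma union_inl_factor_map : factor_map inE /\ injective_gmap inE.
Proof.
apply: closed_embedding_factor_map => //.
- by move=> e; exact: union_rngl.
- by move=> e; exact: union_srcl.
elim/union_edge_ind => e v; first by exists e.
rewrite union_rngr// => /esym/union_vlr[g _ /esym re].
have [ff _] := sub_incl_factor_map _ regG.
have [a _ <-] := rng_lift _ ff _ _ (esym re).
by exists (emap m a) => //; exact: union_eglue.
Qed.

Lemma union_inr_factor_map : factor_map inF /\ injective_gmap inF.
Proof.
apply: closed_embedding_factor_map => //.
- by move=> e; exact: union_rngr.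
- by move=> e; exact: union_srcr.
elim/union_edge_ind => e v; last by exists e.
rewrite union_rngl// => /union_vlr[g re _].
have [a _ <-] := rng_lift _ fm _ _ re.
by exists (emap incl a) => //; rewrite -union_eglue.
Qed.

(** * Regular and singular vertices of the union *)

Lemma union_vfin u :
  (forall x, vmap inE x = u -> vfin x) ->
  (forall y, vmap inF y = u -> vfin y) ->
  vfin u.
Proof.
case: topE => lE _ sE _; case: topF => lF _ sF _ fE fF.
have [B nB cB] : exists2 B : set (vert E),
    (forall x, vmap inE x = u -> nbhs x B) & compact (src @^-1` B).
  have [[x xu]|nx] := pselect (exists x, vmap inE x = u).
    have [B nB cB] := fE x xu; exists B => // x'.
    by case: vl => _ vi _; rewrite -xu => /vi ->.
  by exists set0; [move=> x xu; case: nx; exists x|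
    rewrite preimage_set0; exact: compact0].
have [C nC cC] : exists2 C : set (vert F),
    (forall y, vmap inF y = u -> nbhs y C) & compact (src @^-1` C).
  have [[y yu]|ny] := pselect (exists y, vmap inF y = u).
    have [C nC cC] := fF y yu; exists C => // y'.
    by case: vr => _ vi _; rewrite -yu => /vi ->.
  by exists set0; [move=> y yu; case: ny; exists y|
    rewrite preimage_set0; exact: compact0].
(* Closedness of [K] makes its source preimage a union of images of closed subsets of two compact
   sets. *)
have [K [nK cK KB KC]] : exists K : set (vert U),
    [/\ nbhs u K, closed K, vmap inE @^-1` K `<=` B & vmap inF @^-1` K `<=` C].
  exact: adj_closed_nbhs em.1 ei.1 u _ _ lE lF nB nC.
exists K => //.
have -> : src @^-1` K =
    emap inE @` (src @^-1` (vmap inE @^-1` K)) `|`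
    emap inF @` (src @^-1` (vmap inF @^-1` K)).
  apply/seteqP; split; last first.
    move=> _ [] [e Ke <-].
      by change (K (src (emap inE e))); rewrite union_srcl.
    by change (K (src (emap inF e))); rewrite union_srcr.
  elim/union_edge_ind => e Ke; [left|right]; exists e => //.
    by change (K (vmap inE (src e))); rewrite -union_srcl.
  by change (K (vmap inF (src e))); rewrite -union_srcr.
case: vl => vlc _ _; case: vr => vrc _ _.
case: el => elc _ _; case: er => erc _ _.
apply: compactU; apply: continuous_compact; try exact: continuous_subspaceT.
  apply: subclosed_compact cB _; last by move=> e /KB.
  apply: preimage_closed => [? _|]; first exact: sE.
  by apply: preimage_closed => [? _|//]; exact: vlc.
apply: subclosed_compact cC _; last by move=> e /KC.
apply: preimage_closed => [? _|]; first exact: sF.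
by apply: preimage_closed => [? _|//]; exact: vrc.
Qed.

Lemma union_range_src : range (@src U) =
  vmap inE @` range (@src E) `|` vmap inF @` range (@src F).
Proof.
apply/seteqP; split.
  move=> _ [e _ <-]; elim/union_edge_ind: e => e.
    by left; exists (src e) => //; rewrite union_srcl.
  by right; exists (src e) => //; rewrite union_srcr.
by move=> _ [[_ [e _ <-] <-]|[_ [e _ <-] <-]];
  [exists (emap inE e); rewrite ?union_srcl
  |exists (emap inF e); rewrite ?union_srcr].
Qed.

Lemma union_closure_range_src : closure (range (@src U)) =
  vmap inE @` closure (range (@src E)) `|` vmap inF @` closure (range (@src F)).
Proof.
rewrite union_range_src closureU.
by rewrite (closed_embedding_closure _ _ vl) (closed_embedding_closure _ _ vr).
Qed.

Lemma union_vreg u :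
  (forall x, vmap inE x = u -> vreg x) ->
  (forall y, vmap inF y = u -> vreg y) ->
  vreg u.
Proof.
move=> rE rF; apply/vregP; split.
  by apply: union_vfin => [x /rE[]|y /rF[]].
rewrite union_closure_range_src; apply: (nbhs_adj em.1 ei.1) => [x /rE|y /rF].
  by move=> /vregP[_]; apply: filterS => z; left; exists z.
by move=> /vregP[_]; apply: filterS => z; right; exists z.
Qed.

(** Such a vertex is a limit of sources within [E] or within [F]; it is finite there too by
    properness, so [vfin_emits] gives an edge. *)
Lemma union_vreg_emits u : vreg u -> range (@src U) u.
Proof.
have [fE _] := union_inl_factor_map; have [fF _] := union_inr_factor_map.
move=> /vregP[fu /nbhs_singleton].
rewrite union_closure_range_src union_range_src.
case=> -[x cx xu]; [left|right]; exists x => //; apply: vfin_emits => //.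
  by apply: (vfin_factor_map _ fE); rewrite xu.
by apply: (vfin_factor_map _ fF); rewrite xu.
Qed.

(* If g were singular in G, E-sinks would lie arbitrarily close to g; as they
   emit edges of the union, they lie in G, are singular in G, hence in F, and
   are limits of F-sinks.  Such F-sinks in turn emit an edge of the union, hence
   of E, and lie in G; but they are close to an E-sink, so they are E-sinks. *)
Lemma union_vreg_inI g : vreg (vmap inG g) -> vreg g.
Proof.
have [fE [iE _]] := union_inl_factor_map.
have [fF [iF _]] := union_inr_factor_map.
have [_ _ ms _] := fm.
have singF h : vsing h -> vsing (vmap incl h).
  by move=> sh; apply: (sub_incl_vsing _ regG); exists h.
case: vl => vlc _ _; case: vr => vrc _ _.
have -> : vmap inG g = vmap inE (vmap m g) by rewrite union_vglue.
move=> rg; apply: contrapT => sg.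
have sE : vsing (vmap m g) by apply: regm.2; exists g.
have fiE : vfin (vmap m g) by apply: (vfin_factor_map _ fE); case: rg.
have nE : nbhs (vmap m g) (vmap inE @^-1` @vreg U).
  by apply: vlc; exact: vreg_nbhs.
have [x1 [kx1 rx1]] := vsing_vfin_sink _ sE fiE _ nE.
have nosrc x e : vsink x -> src e = x :> vert E -> False.
  by move=> kx ex; apply: kx; apply: subset_closure; exists e.
have [g1 x1E] : exists g1, x1 = vmap m g1.
  have := union_vreg_emits _ rx1; rewrite union_range_src.
  case=> -[_ [e _ <-]]; first by move=> /iE /(nosrc _ _ kx1).
  by move=> /esym/union_vlr[g1 ->]; exists g1.
rewrite {}x1E {x1} in kx1 rx1.
have sg1 : vsing g1.
  move=> /(vreg_emits _ topG)[e _ eg1].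
  by apply: (nosrc _ (emap m e) kx1); rewrite ms eg1.
have fiF : vfin (vmap incl g1).
  by apply: (vfin_factor_map _ fF); rewrite -union_vglue; case: rx1.
have [[mc _ _] _] := em.
(* The trace of [O] on [G] consists of the vertices that [m] sends to sinks of [E]; the sink [y] of
   [F] below is taken in [O]. *)
have [O oO OE] : open (vmap m @^-1` @vsink E).
  by apply: open_comp => [? _|]; [exact: mc|exact: vsink_open].
have nF : nbhs (vmap incl g1) (O `&` vmap inF @^-1` @vreg U).
  apply: filterI.
    apply: open_nbhs_nbhs; split=> //.
    by rewrite -[O _]/((set_val @^-1` O) g1) OE.
  by apply: vrc; apply: vreg_nbhs; rewrite -union_vglue.
have [y [ky [Oy ry]]] := vsing_vfin_sink _ (singF _ sg1) fiF _ nF.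
have := union_vreg_emits _ ry; rewrite union_range_src.
case=> -[_ [e _ <-]].
  move=> /union_vlr[g2 eg2 yE]; apply: nosrc _ _ eg2.
  by rewrite yE in Oy; rewrite -[vsink _]/((vmap m @^-1` @vsink E) g2) -OE.
by move=> /iF ey; apply: ky; apply: subset_closure; exists e.
Qed.

(** A vertex of [E] regular in the union emits an edge of the union. If that edge is from [F], the
    vertex is in [G] and regular there, so it emits an edge of [G], which [m] carries into [E]. *)
Lemma union_inl_vsing : vmap inE @` @vsing E `<=` @vsing U.
Proof.
have [fE [iE _]] := union_inl_factor_map; have [_ _ ms _] := fm.
move=> _ [x sx <-] rx; apply: sx; move: x rx.
apply: (vreg_factor_map _ fE) => x rx.
have := union_vreg_emits _ rx; rewrite union_range_src.
case=> -[_ [e _ <-]]; first by move=> /iE <-; exists e.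
move=> /esym/union_vlr[g xg _].
have /union_vreg_inI/(vreg_emits _ topG)[a _ ag] : vreg (vmap inG g).
  by change (vreg (vmap inF (vmap incl g))); rewrite -union_vglue -xg.
by exists (emap m a) => //; rewrite ms ag.
Qed.

Lemma union_inr_vsing : vmap inF @` @vsing F `<=` @vsing U.
Proof.
have [fF [iF _]] := union_inr_factor_map.
move=> _ [y sy <-] ry; apply: sy; move: y ry.
apply: (vreg_factor_map _ fF) => y ry.
have := union_vreg_emits _ ry; rewrite union_range_src.
case=> -[_ [e _ <-]]; last by move=> /iF <-; exists e.
move=> /union_vlr[g _ yg].
have /union_vreg_inI/(vreg_emits _ topG)[a _ ag] : vreg (vmap inG g).
  by rewrite yg in ry.
by exists (emap incl a) => //; rewrite yg -ag.
Qed.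

Lemma union_vsing u : vsing u ->
  (exists2 x, vsing x & vmap inE x = u) \/
  (exists2 y, vsing y & vmap inF y = u).
Proof.
move=> su; apply: contrapT => /not_orP[nE nF]; apply: su.
apply: union_vreg => [x xu|y yu]; apply: contrapT => s.
  by apply: nE; exists x.
by apply: nF; exists y.
Qed.

(** * Boundary paths of the union and of the intersection *)

Lemma union_infinite_path x : infinite_paths x ->
  (forall k, range (emap inE) (x k)) \/ (forall k, range (emap inF) (x k)).
Proof.
have [fE _] := union_inl_factor_map; have [fF _] := union_inr_factor_map.
move=> px.
have [|/existsNP[k nk]] := pselect (forall k, range (emap inE) (x k)).
  by left.
(* The edge at index [maxn k j] lies in [E] or [F], and then so do all earlier ones; the edge at [k]
   excludes [E]. *)
right=> j; have jn := leq_maxr k j; move: (leq_maxl k j) jn.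
have: range (emap inE) (x (maxn k j)) \/ range (emap inF) (x (maxn k j)).
  by elim/union_edge_ind: (x _) => e; [left|right]; exists e.
case=> xn kn jn; last exact: infinite_paths_prefix px xn jn.
by case: nk; exact: infinite_paths_prefix px xn kn.
Qed.

Lemma union_boundary : @boundary U =
  bpath_map inE @` @boundary E `|` bpath_map inF @` @boundary F.
Proof.
have [fE iE] := union_inl_factor_map; have [fF iF] := union_inr_factor_map.
apply/seteqP; split; last first.
  move=> b [].
    apply: (boundary_factor_map _ fE iE); exact: union_inl_vsing.
  apply: (boundary_factor_map _ fF iF); exact: union_inr_vsing.
move=> _ [[x px <-]|[p [pp sp] <-]].
  by have [xE|xF] := union_infinite_path _ px; [left|right];
    exact: boundary_lift_infinite.
have [[v sv vp]|[v sv vp]] := union_vsing _ sp; [left|right].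
  exact: boundary_lift_finite (esym vp) sv.
exact: boundary_lift_finite (esym vp) sv.
Qed.

Hypothesis hsing :
  vmap inE @` @vsing E `&` vmap inG @` @vreg G `<=` vmap inF @` @vreg F.

(** Were [g] regular in [G], [hsing] would make it regular in [F], since its image in [E] is
    singular. *)
Lemma vsing_inI g : vsing (vmap m g) -> vsing (vmap incl g) -> vsing g.
Proof.
have [_ [iF _]] := union_inr_factor_map.
move=> sm si rg; have [|y ry /iF yE] := hsing (vmap inG g).
  by split; [exists (vmap m g) => //; exact: union_vglue|exists g].
by apply: si; rewrite -yE.
Qed.

Lemma union_inI_boundary : bpath_map inG @` @boundary G =
  bpath_map inE @` @boundary E `&` bpath_map inF @` @boundary F.
Proof.
have [fE iE] := union_inl_factor_map; have [fF iF] := union_inr_factor_map.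
have [fi ii] := sub_incl_factor_map _ regG.
have bE (b : bpath G) : bpath_map inG b = bpath_map inE (bpath_map m b).
  rewrite union_inIE; case: b => [[v|e s]|x] //=.
  by rewrite map_comp.
have bF (b : bpath G) : bpath_map inG b = bpath_map inF (bpath_map incl b).
  by case: b => [[v|e s]|x] //=; rewrite map_comp.
apply/seteqP; split.
  move=> _ [b bG <-]; split.
    exists (bpath_map m b); last by rewrite bE.
    apply: (boundary_factor_map _ fm injm regm.2).
    by exists b.
  exists (bpath_map incl b); last by rewrite bF.
  by apply: (boundary_factor_map _ fi ii (sub_incl_vsing _ regG)); exists b.
move=> _ [[_ [[x px <-]|[p [pp sp] <-]] <-] [_ [[y py <-]|[q [qp sq] <-]] //]].
  (* Every edge of the common infinite path comes from both [E] and [F], hence from [G]. *)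
  move=> [] xy; have yi k : range (emap incl) (y k).
    by have /esym/union_elr[g _ ->] := congr1 (@^~ k) xy; exists g.
  have [b bG by_] := boundary_lift_infinite _ fi ii _ py yi.
  exists b => //; rewrite bF by_.
  by congr InfinitePath.
(* For finite paths it is enough to compare ranges: the common range is a vertex of [G], singular by
   [vsing_inI], and the whole path lifts to [G] from it. *)
move=> [] pq; have := congr1 (@fpath_rng _) pq.
rewrite !fpath_rng_map// => /esym/union_vlr[g pg qg].
have sg : vsing g by apply: vsing_inI; rewrite -?pg -?qg.
have [b bG bq] := boundary_lift_finite _ fi ii _ _ qp qg sg.
by exists b => //; rewrite bF bq /= pq.
Qed.

End RegularUnion.

Theorem proposition4p15 (E F : graph) (G : subgraph F) (m : gmap G E)
    (topE : topological_graph E) (topF : topological_graph F)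
    (regG : closed_regular_subgraph G)
    (regm : regular_factor_map m) (injm : injective_gmap m)
    (hsing : vmap (union_inl m) @` @vsing E `&` vmap (union_inI m) @` @vreg G
               `<=` vmap (union_inr m) @` @vreg F) :
  @boundary (union_graph m) =
    bpath_map (union_inl m) @` @boundary E `|`
    bpath_map (union_inr m) @` @boundary F
  /\
  bpath_map (union_inI m) @` @boundary G =
    bpath_map (union_inl m) @` @boundary E `&`
    bpath_map (union_inr m) @` @boundary F.
Proof.
split; first exact: union_boundary topE topF regG regm injm.
exact: union_inI_boundary topE regG regm injm hsing.
Qed.
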